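(* Let $q$ be a power of $2$, let $b\in\mathbb{F}_{q^6}$ with $b\neq 0$, and let $U_b=\{(x,\,bx^q+x^{q^4}) : x\in\mathbb{F}_{q^6}\}$. Then $U_b$ is a maximum scattered $\mathbb{F}_q$-subspace of $\mathbb{F}_{q^6}\times\mathbb{F}_{q^6}$ if and only if $$B\neq 0,\qquad N\in\mathbb{F}_{q^3}\setminus\{0,1\},\qquad \mathrm{Tr}_{q^3/2}(AC/B^2)=0.$$
   Context: An $\mathbb{F}_q$-subspace $U$ of $V=\mathbb{F}_{q^6}\times\mathbb{F}_{q^6}$ is called scattered if $\dim_{\mathbb{F}_q}(U\cap \langle \mathbf{u}\rangle_{\mathbb{F}_{q^6}})\le 1$ for every nonzero $\mathbf{u}\in V$; it is maximum scattered if moreover $\dim_{\mathbb{F}_q}U=6$. Here $N:=b^{q^3+1}\in\mathbb{F}_{q^3}$, $A:=b^{q+1}$, $B:=N^{q^2+q+1}+N+N^q+N^{q^2}\in\mathbb{F}_q$ and $C:=A^{q^3}(N+1)^{q^2+q+1}$. When $B\neq0$ one has $AC/B^2\in\mathbb{F}_{q^3}$, and $\mathrm{Tr}_{q^3/2}$ denotes the absolute trace $\mathbb{F}_{q^3}\to\mathbb{F}_2$. *)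

(* Defs.v *)
From HB Require Import structures.
From mathcomp Require Import all_boot all_fingroup all_algebra all_solvable all_field.

Set Implicit Arguments.
Unset Strict Implicit.
Unset Printing Implicit Defensive.

Import GRing.Theory.
Local Open Scope ring_scope.

Section Scattered.

Variables (F : finFieldType) (L : fieldExtType F).
Local Notation q := #|F|.

Lemma frobenius_linear (k : nat) (a : F) (x y : L) :
  (a *: x + y) ^+ (q ^ k) = a *: x ^+ (q ^ k) + y ^+ (q ^ k).
Proof.
have [p p_pr pF] := finPcharP F.
have pL : p \in [pchar L] by rewrite (fmorph_pchar (in_alg L)).
rewrite exprDn_pchar; last first.
  rewrite (eq_pnat _ (pcharf_eq pL)) pnatX -cardsT.
  by have /abelem_pgroup := fin_ring_pchar_abelem pF; rewrite /pgroup => ->.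
rewrite exprZn; congr (_ *: _ + _).
by elim: k => [|k IHk]; rewrite ?expr1 // expnSr exprM IHk expf_card.
Qed.

Definition line_map (u : (L * L)%type) (c : L) : (L * L)%type :=
  (c * u.1, c * u.2).

Fact line_map_is_linear u : linear (line_map u).
Proof.
by move=> a x y; rewrite /line_map !mulrDl -!scalerAl.
Qed.

HB.instance Definition _ u :=
  GRing.isLinear.Build F L (L * L)%type _ (line_map u) (line_map_is_linear u).

Definition Lspan (u : (L * L)%type) : {vspace (L * L)%type} :=
  limg (linfun (line_map u)).

Lemma LspanP (u v : (L * L)%type) :
  reflect (exists c : L, v = (c * u.1, c * u.2)) (v \in Lspan u).
Proof.
apply: (iffP memv_imgP) => [[c _ ->]|[c ->]]; exists c; rewrite ?memvf //.
  by rewrite lfunE.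
by rewrite lfunE.
Qed.

Definition scattered (U : {vspace (L * L)%type}) : Prop :=
  forall u : (L * L)%type, u != 0 -> (\dim (U :&: Lspan u) <= 1)%N.

Definition max_scattered (U : {vspace (L * L)%type}) : Prop :=
  scattered U /\ \dim U = 6.

Definition U_map (b x : L) : (L * L)%type :=
  (x, b * x ^+ q + x ^+ (q ^ 4)).

Fact U_map_is_linear b : linear (U_map b).
Proof.
move=> a x y; rewrite /U_map -{1}(expn1 q) !frobenius_linear expn1.
by rewrite mulrDr addrACA -scalerAr -scalerDr.
Qed.

HB.instance Definition _ b :=
  GRing.isLinear.Build F L (L * L)%type _ (U_map b) (U_map_is_linear b).

Definition U_space (b : L) : {vspace (L * L)%type} := limg (linfun (U_map b)).

Lemma U_spaceP (b : L) (v : (L * L)%type) :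
  reflect (exists x : L, v = (x, b * x ^+ q + x ^+ (q ^ 4))) (v \in U_space b).
Proof.
apply: (iffP memv_imgP) => [[c _ ->]|[c ->]]; exists c; rewrite ?memvf //.
  by rewrite lfunE.
by rewrite lfunE.
Qed.

End Scattered.

Lemma sum_cycle (gT : finGroupType) (a : gT) (V : nmodType) (f : gT -> V) :
  \sum_(y in <[a]>%g) f y = \sum_(i < #[a]%g) f (a ^+ i)%g.
Proof.
rewrite (reindex (fun i : 'I_#[a]%g => (a ^+ i)%g)) /=.
  by apply: eq_bigl => i; rewrite mem_cycle.
have ex_i y : y \in <[a]>%g -> exists i : 'I_#[a]%g, y == (a ^+ i)%g.
  by case/cyclePmin=> i lt_i ->; exists (Ordinal lt_i).
exists (fun y => odflt (Ordinal (order_gt0 a))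
                   [pick i : 'I_#[a]%g | y == (a ^+ i)%g]).
  move=> i _; case: pickP => /= [k|/(_ i)]; last by rewrite eqxx.
  by rewrite eq_expg_mod_order !modn_small // => /eqP/val_inj.
by move=> y /ex_i[i0 y0]; case: pickP => /= [k /eqP//|/(_ i0)]; rewrite y0.
Qed.

(* x + x^p + ... + x^(p^(m-1)): the absolute trace from the field with p^m
   elements to its prime field, computed in any overfield E and with its value
   seen in E; it agrees with galTrace by galTrace_abs_trace. *)
Definition abs_trace (p m : nat) (E : pzRingType) (x : E) : E :=
  \sum_(i < m) x ^+ (p ^ i).

Lemma galTrace_abs_trace (p m : nat) (E : finFieldType)
    (charE : p \in [pchar E]) (x : pPrimeCharType charE) :
  #|E| = (p ^ m)%N -> galTrace 1 {: pPrimeCharType charE} x = abs_trace p m x.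
Proof.
set P := pPrimeCharType charE => oE.
have p_pr := pcharf_prime charE.
have [alpha genG Da] := finField_galois_generator (sub1v {:P}%AS).
have dimP : \dim {:P} = m by rewrite pprimeChar_dimf oE pfactorK.
have oa : #[alpha]%g = m.
  by rewrite orderE -(eqP genG) -(galois_dim (finField_galois (sub1v _)))
             dimv1 divn1.
have aX i : (alpha ^+ i)%g x = x ^+ (p ^ i).
  elim: i => [|i IHi]; first by rewrite gal_id expr1.
  rewrite expgSr galM ?memvf // IHi Da ?memvf //.
  by rewrite dimv1 card_Fp // expn1 -exprM expnSr.
rewrite /galTrace (eqP genG) sum_cycle oa.
by apply: eq_bigr => i _; rewrite aX.
Qed.

(* Main.v *)
From HB Require Import structures.
Require Import Defs.
From mathcomp Require Import all_boot all_fingroup all_algebra all_solvable all_field.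
From mathcomp Require Import ring.

Import GRing.Theory.
Local Open Scope ring_scope.

(* Write x_i for x^(q^i), f(x) = b x_1 + x_4 and N_i for the conjugates of N.
   U_b is not scattered iff some f - m has two F_q-independent roots x, y. The
   L-plane spanned by (x_i) and (y_i) is invariant under the Frobenius shift, and
   its Pluecker coordinates p_ij = x_i y_j + x_j y_i satisfy
   p_(i,i+4) = b_i p_(i,i+1). With a = p_01 and z = b_3 a_3 / (b_5 a), the Pluecker
   relations say exactly that
     z z_3 N_2 = N_0, N_0 z_1 (1 + N_2 z) = N_0 + N_2 z and
     N_1 z_2 (z + N_0) = N_0 + N_2 z;
   they imply N_2 (N_1 + 1) z^2 + B z + N_0 (N_1 + 1) = 0, which for B <> 0 is the
   Artin-Schreier equation w^2 + w = c with c = N_0 N_2 (N_1 + 1)^2 / B^2. As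
   z = z_3 would force B z = 0, w is not in F_(q^3), that is Tr(c) <> 0; and
   A C / B^2 differs from a conjugate of c by some v^2 + v with v in F_(q^3).
   Conversely B = 0 (take z^2 = N_0 / N_2) or Tr(c) <> 0 yields such a z, then a by
   Hilbert 90, and the plane with these Pluecker coordinates gives back x and y. *)

(** * Absolute traces and Artin-Schreier equations in characteristic 2 *)

Lemma abs_traceD (R : comNzRingType) (n : nat) (x y : R) :
  2%N \in [pchar R] -> abs_trace 2 n (x + y) = abs_trace 2 n x + abs_trace 2 n y.
Proof.
move=> char2; rewrite /abs_trace -big_split; apply: eq_bigr => i _ /=.
by rewrite exprDn_pchar // (eq_pnat _ (pcharf_eq char2)) pnatX pnat_id.
Qed.

Lemma abs_trace_rmorph (R R' : pzRingType) (f : {rmorphism R -> R'}) (p n : nat) (x : R) :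
  abs_trace p n (f x) = f (abs_trace p n x).
Proof. by rewrite /abs_trace rmorph_sum; apply: eq_bigr => i _; rewrite rmorphXn. Qed.

(** The sum telescopes: squaring shifts the terms of the trace by one, and repeated terms cancel in
    characteristic 2. *)
Lemma abs_trace_artin_schreier (R : comNzRingType) (n : nat) (w : R) :
  2%N \in [pchar R] -> abs_trace 2 n (w ^+ 2 + w) = w ^+ (2 ^ n) + w.
Proof.
move=> char2; rewrite /abs_trace; elim: n => [|n IHn].
  by rewrite big_ord0 expr1 -mulr2n mulrn_pchar.
rewrite big_ord_recr IHn /= exprDn_pchar.
  rewrite -exprM -expnS addrC -addrA; congr (_ + _).
  by rewrite addrA -mulr2n mulrn_pchar ?add0r.
by rewrite (eq_pnat _ (pcharf_eq char2)) pnatX pnat_id.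
Qed.

(* With T the absolute trace polynomial, T(X^2 + X) = X^(2^n) - X splits in E. *)
Lemma artin_schreier_root (n : nat) (E : finFieldType) (c : E) :
    #|E| = (2 ^ n)%N -> abs_trace 2 n c = 0 -> exists w : E, w ^+ 2 + w = c.
Proof.
move=> oE trc.
have n_gt0 : (0 < n)%N by case: n oE {trc} (card_finRing_gt1 E) => [->|].
have char2 : 2%N \in [pchar E] by apply: card_finPcharP oE _.
pose T : {poly E} := \sum_(i < n) 'X^(2 ^ i).
have rootT : root T c.
  by rewrite rootE horner_sum; under eq_bigr do rewrite hornerXn; apply/eqP.
have char2P : 2%N \in [pchar {poly E}] by rewrite (rmorph_pchar (@polyC E)).
have ET : T \Po ('X^2 + 'X) = \prod_x ('X - x%:P).
  rewrite -finField_genPoly oE -[RHS]/('X^(2 ^ n) + - 'X) oppr_pchar2 //.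
  rewrite -(abs_trace_artin_schreier _ _ _ char2P) /T raddf_sum.
  by apply: eq_bigr => i _; rewrite /= comp_Xn_poly.
(* As X - c divides [T], composing with X^2 + X shows that [p] divides a product of linear
   factors. *)
pose p := 'X^2 + 'X - c%:P.
have dvdp : p %| \prod_x ('X - x%:P).
  have /dvdpP[r Er] : 'X - c%:P %| T by rewrite dvdp_XsubCl.
  by rewrite -ET Er comp_polyM comp_polyB comp_polyX comp_polyC dvdp_mull.
have size_p : size p = 3.
  by rewrite /p -addrA size_polyDl size_polyXn // -polyCN size_XaddC.
case: (dvdp_prod_XsubC dvdp) => m; case: (mask _ _) => [|w s] pE.
  by move/eqp_size: pE; rewrite big_nil size_p size_poly1.
exists w; have : root p w by rewrite (eqp_root pE) big_cons rootM root_XsubC eqxx.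
by rewrite rootE !hornerE => /eqP/subr0_eq.
Qed.

(** * Linearized polynomials over a finite field *)

Section FrobeniusPolynomials.
Variables (F : finFieldType) (L : fieldExtType F).

(** A nonzero polynomial of degree at most q^(n-1), which is less than the cardinality of [L],
    cannot vanish on all of [L]. *)
Lemma linearized_poly_neq0 (n : nat) (c : nat -> L) (i : nat) :
    (i < n)%N -> (n <= \dim {:L})%N -> c i != 0 ->
  exists x : L, \sum_(j < n) c j * x ^+ (#|F| ^ j) != 0.
Proof.
move=> lt_in le_nd ci.
have q_gt1 := card_finRing_gt1 F.
pose p : {poly L} := \sum_(j < n) c j *: 'X^(#|F| ^ j).
have Ep x : p.[x] = \sum_(j < n) c j * x ^+ (#|F| ^ j).
  by rewrite horner_sum; apply: eq_bigr => j _; rewrite hornerZ hornerXn.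
have p_neq0 : p != 0.
  apply: contraNneq ci => p0; have /(congr1 (fun r : {poly L} => r`_(#|F| ^ i))) := p0.
  rewrite coef_sum coef0 (bigD1 (Ordinal lt_in)) //= big1 => [|j neq_ji].
    by rewrite coefZ coefXn eqxx mulr1 addr0 => ->.
  rewrite coefZ coefXn eqn_exp2l // (_ : (i == j) = false) ?mulr0 //.
  by apply/negbTE; apply: contraNneq neq_ji => ij; apply/eqP/val_inj.
have size_p : (size p <= #|finvect_type L|)%N.
  rewrite -(card_vspacef (Vector.class (finvect_type L : vectType F))) card_vspace.
  apply: leq_trans (size_sum _ _ _) _; apply/bigmax_leqP => j _.
  apply: leq_trans (size_scale_leq _ _) _; rewrite size_polyXn.
  by rewrite ltn_exp2l // (leq_trans (ltn_ord j)).
have [x nzx|all0] := pickP (fun x : finvect_type L => p.[x : L] != 0).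
  by exists x; rewrite -Ep.
have : (size (enum (finvect_type L) : seq L) < size p)%N.
  apply: (@max_poly_roots L p (enum (finvect_type L)) p_neq0); last exact: enum_uniq.
  by apply/allP => x _; rewrite rootE; apply: negbFE; apply: (all0 x).
by rewrite ltnNge => /negP[]; move: size_p; rewrite cardE.
Qed.

Lemma expf_card_dim (x : L) : x ^+ (#|F| ^ \dim {:L}) = x.
Proof. by apply/eqP; rewrite -(Fermat's_little_theorem {:L}%AS) memvf. Qed.

End FrobeniusPolynomials.

(** * The q-power map as a ring endomorphism *)

Section Frobenius.
Variables (F : finFieldType) (L : fieldExtType F).

Definition card_pow (x : L) : L := x ^+ #|F|.

Fact card_pow_is_zmod_morphism : zmod_morphism card_pow.
Proof.
move=> x y; have := frobenius_linear 1 (-1) y x.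
by rewrite !scaleN1r !expn1 addrC [_ + x ^+ _]addrC.
Qed.

Fact card_pow_is_monoid_morphism : monoid_morphism card_pow.
Proof. by split=> [|x y]; rewrite /card_pow ?expr1n ?exprMn. Qed.

HB.instance Definition _ :=
  GRing.isZmodMorphism.Build L L card_pow card_pow_is_zmod_morphism.
HB.instance Definition _ :=
  GRing.isMonoidMorphism.Build L L card_pow card_pow_is_monoid_morphism.

(** The existential hides the power behind an abstract [S], so that the later algebra uses only the
    morphism laws. *)
Lemma exists_frobenius : exists S : {rmorphism L -> L}, forall x, S x = x ^+ #|F|.
Proof. by exists card_pow. Qed.

End Frobenius.

(** * Identities in characteristic 2 for a field with an endomorphism [S] *)

Section Semilinear.
Variables (L : fieldType) (S : {rmorphism L -> L}).
Hypothesis two_eq0 : 2%:R = 0 :> L.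
Local Notation S3 x := (S (S (S x))).

(* [ring: two_eq0] only cancels the coefficient 2 itself. *)
Lemma three_eq1 : 3%:R = 1 :> L.
Proof. by rewrite (natrD _ 2 1) two_eq0 add0r. Qed.

Lemma four_eq0 : 4%:R = 0 :> L.
Proof. by rewrite (natrD _ 2 2) two_eq0 add0r. Qed.

Lemma eq_char2 (x y : L) : x + y = 0 -> x = y.
Proof.
move=> h; rewrite -[LHS]addr0 -h; transitivity (y + 2%:R * x); first by ring.
by rewrite two_eq0 mul0r addr0.
Qed.

Lemma char2_eq (x y : L) : x = y -> x + y = 0.
Proof. by move=> ->; ring: two_eq0. Qed.

Lemma sqrf_char2_inj (x y : L) : x ^+ 2 = y ^+ 2 -> x = y.
Proof.
move/char2_eq => h; apply: eq_char2; apply/eqP; rewrite -sqrf_eq0 -h; apply/eqP.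
by ring: two_eq0.
Qed.

(** The first two relations read (1 + n0 z1)(1 + n2 z0) = n0 + 1 and (1 + n1 z2)(1 + n0 z1) = n1 +
    1. Cross-multiplying removes z1; the third relation, linear in z2, then removes z2. *)
Lemma cross_ratio_quadratic (n0 n1 n2 z0 z1 z2 : L) :
  n0 * z1 * (1 + n2 * z0) = n0 + n2 * z0 ->
  n1 * z2 * (1 + n0 * z1) = n1 + n0 * z1 ->
  n1 * z2 * (z0 + n0) = n0 + n2 * z0 ->
  n2 * (n1 + 1) * z0 ^+ 2 + (n0 * n1 * n2 + n0 + n1 + n2) * z0 + n0 * (n1 + 1) = 0.
Proof.
move=> /char2_eq e1 /char2_eq e2 /char2_eq e3.
transitivity ((n0 + 1) * (n1 * z2 * (z0 + n0) + (n0 + n2 * z0))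
  + (z0 + n0) * ((1 + n2 * z0) * (n1 * z2 * (1 + n0 * z1) + (n1 + n0 * z1))
     + (n1 * z2 + 1) * (n0 * z1 * (1 + n2 * z0) + (n0 + n2 * z0)))).
  by ring: two_eq0.
by rewrite e1 e2 e3; ring.
Qed.

(** With denominators cleared this is (n0 + 1)(n1 + 1) = (n0 n1 + 1)(n2 + 1) + B. It trades A C /
    B^2 for a conjugate of c up to v^2 + v, which has trace 0 when v is in F_(q^3). *)
Lemma trace_class_shift (n0 n1 n2 : L) :
    let B := n0 * n1 * n2 + n0 + n1 + n2 in let v := n0 * n1 * (n2 + 1) / B in
    B != 0 ->
  n0 * n1 * ((n2 + 1) * (n1 + 1) * (n0 + 1)) / B ^+ 2
    = n1 * n0 * (n2 + 1) ^+ 2 / B ^+ 2 + (v ^+ 2 + v).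
Proof.
move=> B v B_neq0; apply: (mulIf (expf_neq0 2 B_neq0)).
transitivity (n0 * n1 * ((n2 + 1) * (n1 + 1) * (n0 + 1))); 
  first by rewrite divfK ?expf_neq0.
transitivity (n1 * n0 * (n2 + 1) ^+ 2 + (n0 * n1 * (n2 + 1)) ^+ 2 
              + n0 * n1 * (n2 + 1) * B).
  by rewrite /B; ring: two_eq0 three_eq1.
by rewrite /v; field.
Qed.

(** * Passing between the cross-ratio [z] and the Artin-Schreier root [w] *)

Section CrossRatio.
Variables n0 n1 n2 : L.
Hypotheses (S_n0 : S n0 = n1) (S_n1 : S n1 = n2) (S_n2 : S n2 = n0).
Hypothesis n0_neq0 : n0 != 0.
Local Notation B := (n0 * n1 * n2 + n0 + n1 + n2).

Lemma quadratic_root_nonfixed (z : L) :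
    B != 0 -> z != 0 -> z * S3 z * n2 = n0 ->
    n2 * (n1 + 1) * z ^+ 2 + B * z + n0 * (n1 + 1) = 0 ->
  exists2 w, w ^+ 2 + w = n0 * n2 * (n1 + 1) ^+ 2 / B ^+ 2 & S3 w != w.
Proof.
move=> B_neq0 z_neq0 zz3 Qz; exists (n2 * (n1 + 1) * z / B).
  apply: eq_char2; transitivity (n2 * (n1 + 1) / B ^+ 2 *
    (n2 * (n1 + 1) * z ^+ 2 + B * z + n0 * (n1 + 1))); last by rewrite Qz mulr0.
  by field.
apply: contraNneq z_neq0.
have SB : S B = B by rewrite !(rmorphD S, rmorphM S, S_n0, S_n1, S_n2); ring.
rewrite !(SB, fmorphV S, rmorphM S, rmorphD S _ 1, rmorph1 S, S_n0, S_n1, S_n2).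
move/(divIf B_neq0) => fixz.
have n2_neq0 : n2 != 0 by rewrite -S_n1 -S_n0 !fmorph_eq0.
(* For n1 = 1 the chosen root is 0 and says nothing about [z], but the quadratic itself reduces to B
   z = 0. *)
have [n11|n11] := eqVneq (n1 + 1) 0.
  move: Qz; rewrite n11 !mulr0 mul0r addr0 add0r => /eqP.
  by rewrite mulf_eq0 (negPf B_neq0).
move: fixz => /(mulfI (mulf_neq0 n2_neq0 n11)) fixz.
move: zz3; rewrite fixz => zz3.
have : B * z = 0.
  rewrite -Qz; transitivity ((n1 + 1) * n0 + B * z + n0 * (n1 + 1)).
    by ring: two_eq0.
  by rewrite -zz3; ring.
by move/eqP; rewrite mulf_eq0 (negPf B_neq0).
Qed.

(** Squaring is injective, so it suffices to compare squares, where z^2 and its conjugates are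
    known. In the last two relations the squares differ by n0 B. *)
Lemma degenerate_cross_ratio (z : L) :
    B = 0 -> z ^+ 2 * n2 = n0 ->
  [/\ z * S3 z * n2 = n0, n0 * S z * (1 + n2 * z) = n0 + n2 * z
    & n1 * S (S z) * (z + n0) = n0 + n2 * z].
Proof.
move=> B0 Ez; have Ez1 := congr1 S Ez; have Ez2 := congr1 S Ez1.
have Ez3 := congr1 S Ez2; rewrite !(rmorphM S, rmorphXn S, S_n0, S_n1, S_n2) /= in Ez1 Ez2 Ez3.
split; apply: sqrf_char2_inj.
- transitivity ((z ^+ 2 * n2) * (S3 z ^+ 2 * n2)); first by ring.
  by rewrite Ez Ez3; ring.
- transitivity ((S z ^+ 2 * n0) * n0 * (1 + n2 * (z ^+ 2 * n2))); first by ring: two_eq0.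
  rewrite Ez Ez1; apply: eq_char2; transitivity (n0 * B); last by rewrite B0 mulr0.
  transitivity (n0 * (n1 + n0 * n1 * n2 + n0) + n2 * (z ^+ 2 * n2)); first by ring: two_eq0.
  by rewrite Ez; ring.
- transitivity ((S (S z) ^+ 2 * n1) * n1 * (z ^+ 2 + n0 ^+ 2)); first by ring: two_eq0.
  rewrite Ez2; apply: eq_char2; transitivity (n0 * B); last by rewrite B0 mulr0.
  transitivity (n1 * (z ^+ 2 * n2) + n0 ^+ 2 * (n1 * n2 + 1) 
    + n2 * (z ^+ 2 * n2)); first by ring: two_eq0.
  by rewrite Ez; ring.
Qed.

Lemma artin_schreier_cross_ratio (w : L) :
    B != 0 -> w ^+ 2 + w = n0 * n2 * (n1 + 1) ^+ 2 / B ^+ 2 -> S3 w != w ->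
  exists z, [/\ z * S3 z * n2 = n0, n0 * S z * (1 + n2 * z) = n0 + n2 * z
    & n1 * S (S z) * (z + n0) = n0 + n2 * z].
Proof.
move=> B_neq0 Ew w3.
have SB : S B = B by rewrite !(rmorphD S, rmorphM S, S_n0, S_n1, S_n2); ring.
have sum_eq0 (t : L) : t ^+ 2 + t = 0 -> t = 0 \/ t = 1.
  move=> /eqP; have -> : t ^+ 2 + t = t * (t + 1) by ring.
  rewrite mulf_eq0 => /orP[/eqP|/eqP/eq_char2]; [by left | by right].
have n1D1 : n1 + 1 != 0.
  apply: contraNneq w3 => n11; move: Ew; rewrite n11 expr0n /= mulr0 mul0r.
  by case/sum_eq0 => ->; rewrite ?(rmorph0, rmorph1).
have n2D1 : n2 + 1 != 0 by rewrite -S_n1 -(rmorph1 S) -rmorphD fmorph_eq0.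
have n0D1 : n0 + 1 != 0 by rewrite -S_n2 -(rmorph1 S) -rmorphD fmorph_eq0.
have n1_neq0 : n1 != 0 by rewrite -S_n0 fmorph_eq0.
have n2_neq0 : n2 != 0 by rewrite -S_n1 fmorph_eq0.
(* With c the right-hand side of [Ew], this [u] satisfies u^2 + u = c + S c, so that S w + w + u is
   a root of t^2 + t. *)
pose u := n0 * (n1 * n2 + 1) / B.
have Su : S u = n1 * (n2 * n0 + 1) / B.
  by rewrite /u !(SB, fmorphV S, rmorphD S, rmorphM S, rmorph1 S, S_n0, S_n1, S_n2).
have Suu : S (S u) = n2 * (n0 * n1 + 1) / B.
  by rewrite Su !(SB, fmorphV S, rmorphD S, rmorphM S, rmorph1 S, S_n0, S_n1, S_n2).
have tru : u + S u + S (S u) = 1.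
  rewrite Suu Su /u; apply: (mulIf B_neq0); rewrite mul1r.
  transitivity (3%:R * n0 * n1 * n2 + n0 + n1 + n2); first by field.
  by ring: three_eq1.
(* [w + S w + u] is 0 or 1; as [u] has trace 1 over the base field, the value 1
   would make [w] fixed by [S3]. *)
have [|Sw|Sw] := sum_eq0 (S w + w + u).
- have Ew1 := congr1 S Ew; move: Ew1.
  rewrite !(rmorphXn S, SB, fmorphV S, rmorphD S, rmorphM S, rmorph1 S,
    S_n0, S_n1, S_n2) /= => Ew1.
  transitivity ((S w ^+ 2 + S w) + (w ^+ 2 + w) + (u ^+ 2 + u)); first by ring: two_eq0.
  rewrite Ew Ew1 /u; apply: (mulIf (expf_neq0 2 B_neq0)); rewrite mul0r.
  transitivity (n1 * n0 * (n2 + 1) ^+ 2 + n0 * n2 * (n1 + 1) ^+ 2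
    + (n0 * (n1 * n2 + 1)) ^+ 2 + (n0 * (n1 * n2 + 1)) * B); first by field.
  by ring: two_eq0 four_eq0.
- have {}Sw : S w = w + u by apply: eq_char2; rewrite addrA.
  have Sww : S (S w) = w + u + S u by rewrite Sw rmorphD Sw.
  have Swww : S3 w = w + 1 by rewrite Sww !rmorphD Sw -tru !addrA.
  have Ew' : n2 * n0 * (n1 + 1) ^+ 2 = w * (w + 1) * B ^+ 2.
    transitivity ((w ^+ 2 + w) * B ^+ 2); last by ring.
    by rewrite Ew; field.
  (* This inverts the substitution made in [quadratic_root_nonfixed]. With denominators cleared,
     each of the three relations becomes [Ew']. *)
  exists (w * B / (n2 * (n1 + 1))).
  rewrite !(SB, fmorphV S, rmorphM S, rmorphD S _ 1, rmorph1 S, S_n0, S_n1, S_n2).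
  rewrite Swww Sww Sw.
  split.
  + apply: (mulIf n2_neq0); apply: (mulIf (expf_neq0 2 n1D1)).
    transitivity (w * (w + 1) * B ^+ 2); first by field; apply/andP.
    by rewrite -Ew'; ring.
  + apply: (mulIf n2D1); apply: (mulIf n1D1).
    transitivity ((w * B + u * B) * (n1 + 1 + w * B)).
      by field; rewrite n0_neq0 n1D1 n2D1 n2_neq0.
    have -> : u * B = n0 * (n1 * n2 + 1) by rewrite /u divfK.
    apply: eq_char2.
    transitivity (w * (w + 1) * B ^+ 2 + n2 * n0 * (n1 + 1) ^+ 2).
      transitivity ((w * B + n0 * (n1 * n2 + 1)) * (n1 + 1 + w * B)
       + (n0 * (n1 + 1) + w * B) * (n2 + 1)); first by field; apply/andP.
      by ring: two_eq0.
    by rewrite Ew'; apply: char2_eq.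
  + apply: (mulIf n0D1); apply: (mulIf n1D1); apply: (mulIf n2_neq0).
    transitivity ((w * B + u * B + S u * B) * (w * B + n0 * n2 * (n1 + 1))).
      by field; rewrite n0D1 n1D1 n1_neq0 n2_neq0.
    have -> : u * B = n0 * (n1 * n2 + 1) by rewrite /u divfK.
    have -> : S u * B = n1 * (n2 * n0 + 1) by rewrite Su divfK.
    apply: eq_char2.
    transitivity (w * (w + 1) * B ^+ 2 + n2 * n0 * (n1 + 1) ^+ 2).
      transitivity ((w * B + n0 * (n1 * n2 + 1) + n1 * (n2 * n0 + 1))
       * (w * B + n0 * n2 * (n1 + 1))
       + (n0 * (n1 + 1) + w * B) * (n0 + 1) * n2); first by field; apply/andP.
      by ring: two_eq0 three_eq1 four_eq0.
    by rewrite Ew'; apply: char2_eq.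
- case/eqP: w3; have {}Sw : S w = w + u + 1.
    by apply: eq_char2; rewrite !addrA Sw -two_eq0.
  rewrite !(Sw, rmorphD S, rmorph1 S).
  transitivity (w + (u + S u + S (S u)) + 3%:R); first by ring.
  by rewrite tru three_eq1 -addrA; rewrite -[1 + 1]/2%:R two_eq0 addr0.
Qed.

End CrossRatio.

(** * Pluecker coordinates of the plane attached to two solutions with the same [m] *)

Section Eigenplane.
Hypothesis S6 : forall x, S (S (S (S (S (S x))))) = x.
Variable b : L.
Hypothesis b_neq0 : b != 0.
Local Notation N0 := (b * S3 b).
Local Notation N1 := (S b * S (S3 b)).
Local Notation N2 := (S (S b) * S (S (S3 b))).
Local Notation B := (N0 * N1 * N2 + N0 + N1 + N2).

Lemma eigenplane_cross_ratio (m x y : L) :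
    b * S x + S (S3 x) = m * x -> b * S y + S (S3 y) = m * y ->
    x * S y + y * S x != 0 ->
  exists z, [/\ z != 0, z * S3 z * N2 = N0 &
    N2 * (N1 + 1) * z ^+ 2 + B * z + N0 * (N1 + 1) = 0].
Proof.
move=> hx hy; set a := x * S y + y * S x => a_neq0.
have Sa k : S k != 0 = (k != 0) by rewrite fmorph_eq0.
have Eb : x * S (S3 y) + y * S (S3 x) = b * a.
  move/char2_eq: hx => hx; move/char2_eq: hy => hy.
  apply: eq_char2; rewrite /a.
  transitivity (x * (b * S y + S (S3 y) + m * y) + y * (b * S x + S (S3 x) + m * x)).
    by ring: two_eq0.
  by rewrite hx hy; ring.
have Eb1 := congr1 S Eb; have Eb2 := congr1 S Eb1; have Eb3 := congr1 S Eb2.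
(* Indices are modulo 6, so p_03 is fixed by the cube of [S], p_02 = b_2 a_2 and p_13 = b_3 a_3.
   [E2] and [E3] are the Pluecker relations on the indices 0, 1, 2, 3 and 0, 1, 3, 4. *)
have E1 : x * S3 y + y * S3 x = S3 (x * S3 y + y * S3 x).
  by rewrite !(rmorphD S, rmorphM S) !S6; ring.
have E2 : (x * S3 y + y * S3 x) * S a
    = S (S a) * (a + S (S b) * S3 b * S3 a).
  apply/esym; transitivity (S (S a) * a + (S (S b) * S (S a)) * (S3 b * S3 a)).
    by ring.
  move: Eb2 Eb3; rewrite /a !(rmorphD S, rmorphM S) !S6 => <- <-.
  by ring: two_eq0.
have E3 : (x * S3 y + y * S3 x) * S (x * S3 y + y * S3 x)
    = (N0 + 1) * a * S3 a.
  apply/esym; transitivity ((b * a) * (S3 b * S3 a) + a * S3 a); first by ring.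
  move: Eb Eb3; rewrite /a !(rmorphD S, rmorphM S) !S6 => <- <-.
  by ring: two_eq0.
move: (x * S3 y + y * S3 x) E1 E2 E3 => e E1 E2 E3.
clear hx hy Eb Eb1 Eb2 Eb3; clearbody a.
(* Then N2 z = p_02 p_13 / (p_01 p_23) is a cross-ratio of the points (x_i : y_i) for i = 0, 1, 2,
   3. *)
have [z z_neq0 Ez] : exists2 z, z != 0 & z * S (S (S3 b)) * a = S3 b * S3 a.
  exists (S3 b * S3 a / (S (S (S3 b)) * a)).
    by rewrite !(mulf_neq0, invr_eq0, Sa, b_neq0, a_neq0).
  by field; rewrite !(Sa, b_neq0, a_neq0).
have Ez1 := congr1 S Ez; have Ez2 := congr1 S Ez1; have Ez3 := congr1 S Ez2.
have E2' : e * S a = S (S a) * a * (1 + N2 * z).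
  rewrite E2; transitivity (S (S a) * (a + S (S b) * (S3 b * S3 a))); first by ring.
  by rewrite -Ez; ring.
have E21 := congr1 S E2'; have E22 := congr1 S E21; have E23 := congr1 S E22.
move: Ez1 Ez2 Ez3 E21 E23; rewrite !(rmorphD S, rmorphM S, rmorph1 S) !S6 -E1.
move=> Ez1 Ez2 Ez3 E21 E23.
have zz3 : z * S3 z * N2 = N0.
  have nz : S3 b * S3 a * (S (S (S3 b)) * a) != 0.
    by rewrite !mulf_neq0 // !(Sa, b_neq0, a_neq0).
  apply: (mulfI nz).
  transitivity ((z * S (S (S3 b)) * a) * (S3 z * S (S b) * S3 a) * (S3 b * S (S (S3 b)))).
    by ring.
  by rewrite Ez Ez3; ring.
have R1 : N0 * S z * (1 + N2 * z) = N0 + N2 * z.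
  (* This gives the factored form (1 + N2 z)(1 + N0 z1) = N0 + 1, which is [E3] after [E2'] and its
     conjugate. *)
  apply: (@addrI _ (1 + N2 * z)).
  have nz : a * S a * S (S a) * S3 a != 0 by rewrite !mulf_neq0 // !Sa.
  apply: (mulfI nz).
  transitivity ((S (S a) * a * (1 + N2 * z)) * (S3 a * S a * (1 + S3 b * b * S z))).
    by ring.
  rewrite -E2' -E21.
  transitivity (e * S e * S a * S (S a)); first by ring.
  by rewrite E3; ring: two_eq0.
have R2 := congr1 S R1.
rewrite !(rmorphD S, rmorphM S, rmorph1 S) !S6 in R2.
exists z; split=> //.
apply: (@cross_ratio_quadratic N0 N1 N2 z (S z) (S (S z))) => //.
- transitivity (S b * S (S3 b) * S (S z) * (1 + S3 b * b * S z)); first by ring.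
  by rewrite R2; ring.
(* The third relation comes from equating the values of [e] given by [E2'] and by its third
   conjugate [E23]. *)
rewrite -R1.
have nz : a * S a * S (S a) * S (S (S3 b)) != 0 by rewrite !mulf_neq0 // !Sa.
apply: (mulfI nz); rewrite -{1}zz3.
transitivity (S (S z) * S b * S (S a) * (z * S (S (S3 b)) * a) * S (S3 b) * S a
              * (1 + S (S (S3 b)) * S (S b) * S3 z)); first by ring.
rewrite Ez Ez2.
transitivity (S3 b * S (S3 b) * S (S (S3 b)) * S a
  * (S (S (S3 a)) * S3 a * (1 + S (S (S3 b)) * S (S b) * S3 z))); first by ring.
rewrite -E23.
transitivity (S3 b * S (S (S3 b)) * (S (S3 b) * S (S3 a)) * (e * S a)); first by ring.
by rewrite -Ez1 E2'; ring.
Qed.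

(* The coefficient of [S^i l] is the Pluecker coordinate [p_{i0}] of the
   eigenplane, where [a = p_{01}] and [e = p_{03}]. *)
Definition eigenplane_map (a e l : L) : L :=
  a * S l + S (S b) * S (S a) * S (S l) + e * S3 l + b * a * S (S3 l)
  + S (S (S3 a)) * S (S (S3 l)).

(** For a plane coming from x and y, the map is l -> y Tr(x l) + x Tr(y l), with values in their
    span. The coefficient of [S l] forces m = S e / a; [C2], [C3] and [C5] compare those of S^2 l,
    S^3 l and S^5 l. At l the two terms cancel, and at S^4 l the choice of [m] suffices. *)
Lemma eigenplane_mapP (z a : L) :
    a != 0 -> z * S (S (S3 b)) * a = S3 b * S3 a ->
    z * S3 z * N2 = N0 -> N0 * S z * (1 + N2 * z) = N0 + N2 * z ->
    N1 * S (S z) * (z + N0) = N0 + N2 * z ->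
  exists e m, forall l, b * S (eigenplane_map a e l) + S (S3 (eigenplane_map a e l))
    = m * eigenplane_map a e l.
Proof.
move=> a_neq0 Ea zz3 Ez1 Ez2.
have Sa k : S k != 0 = (k != 0) by rewrite fmorph_eq0.
have Ea1 := congr1 S Ea; have Ea2 := congr1 S Ea1.
rewrite !(rmorphD S, rmorphM S, rmorph1 S) !S6 in Ea1 Ea2.
have [e Ee] : exists e, e * S a = S (S a) * a * (1 + N2 * z).
  by exists (S (S a) * a * (1 + N2 * z) / S a); rewrite divfK // Sa.
(* A coordinate p_03 must be fixed by the cube of [S]; this is what the third relation on [z]
   provides. *)
have fixe : S3 e = e.
  have nz : S a * S (S3 a) != 0 by rewrite mulf_neq0 ?Sa.
  apply: (mulIf nz).
  have Ee3 := congr1 (fun u => S3 u) Ee.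
  rewrite /= !(rmorphD S, rmorphM S, rmorph1 S) !S6 in Ee3.
  transitivity (S3 e * S (S3 a) * S a); first by ring.
  rewrite Ee3; transitivity (e * S a * S (S3 a)); last by ring.
  rewrite Ee.
  have nzb : S3 b * S (S3 b) * S (S (S3 b)) != 0 by rewrite !mulf_neq0 ?Sa.
  apply: (mulfI nzb).
  transitivity ((S3 b * S3 a) * (S (S (S3 b)) * S (S (S3 a))) * S (S3 b) * S a
     * (1 + S (S (S3 b)) * S (S b) * S3 z)); first by ring.
  rewrite -Ea -Ea2.
  transitivity (S (S (S3 b)) * a * S a * S (S a) *
     (N1 * S (S z) * (z + z * S3 z * N2))); first by ring.
  rewrite zz3 Ez2 -Ez1.
  transitivity (S3 b * S (S (S3 b)) * a * S (S a) * (1 + N2 * z)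
     * (S z * b * S a)); first by ring.
  by rewrite Ea1; ring.
have Ee1 := congr1 S Ee; have Ee4 := congr1 (fun u => S (S3 u)) Ee.
rewrite /= !(rmorphD S, rmorphM S, rmorph1 S) !S6 fixe in Ee1 Ee4.
have C2 : b * S a + S (S3 b) * S (S3 a) = S e / a * (S (S b) * S (S a)).
  rewrite -Ea1; have nz : S3 b * a != 0 by rewrite mulf_neq0 ?Sa.
  apply: (mulfI nz).
  transitivity (a * S a * (N0 + N0 * S z)); first by ring.
  have -> : N0 + N0 * S z = N2 * z * (1 + N0 * S z).
    apply: (@addrI _ (N2 * z + N0 * S z * (1 + N2 * z))).
    by rewrite {1}Ez1; ring: two_eq0.
  transitivity (S3 b * S (S b) * (S e * S (S a))); last by field.
  rewrite Ee1; transitivity (S (S b) * S a * (1 + N0 * S z) * (S3 b * S3 a)); last by ring.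
  by rewrite -Ea; ring.
have C3 : b * S3 b * S3 a + S3 a = S e / a * e.
  have nz : a * S a * S (S a) != 0 by rewrite !mulf_neq0 ?Sa.
  apply: (mulfI nz).
  transitivity (a * S a * S (S a) * S3 a * (N0 + 1)); first by ring.
  transitivity ((e * S a) * (S e * S (S a))); last by field.
  rewrite Ee Ee1.
  have -> : N0 + 1 = (1 + N2 * z) * (1 + N0 * S z).
    transitivity (1 + N2 * z + N0 * S z * (1 + N2 * z)); last by ring.
    by rewrite Ez1; ring: two_eq0.
  by ring.
have C5 : b * S b * S a + S (S3 a) = S e / a * S (S (S3 a)).
  apply: (mulfI a_neq0); transitivity (S e * S (S (S3 a))); last by field.
  rewrite Ee4; have nz : S z * S (S3 b) != 0.
    rewrite mulf_neq0 ?Sa //; apply: contraTneq (mulf_neq0 b_neq0 (_ : S3 b != 0)).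
      by move=> z0; rewrite -zz3 z0 !mul0r eqxx.
    by rewrite !Sa.
  have zz4 := congr1 S zz3; rewrite !(rmorphD S, rmorphM S, rmorph1 S) !S6 in zz4.
  apply: (mulfI nz).
  transitivity (a * S (S3 a) * (S z * S (S3 b)
    + S (S3 b) * (S z * S (S3 z) * (S3 b * b)))); last by ring.
  rewrite zz4.
  transitivity (a * S (S3 b) * (S b * (S z * b * S a) + S z * S (S3 a))).
    by ring.
  by rewrite Ea1; ring.
exists e, (S e / a) => l.
rewrite /eigenplane_map !(rmorphD S, rmorphM S, rmorph1 S) !S6 fixe.
transitivity (S e * S l + (b * S a + S (S3 b) * S (S3 a)) * S (S l)
  + (b * S3 b * S3 a + S3 a) * S3 l + b * S e * S (S3 l)
  + (b * S b * S a + S (S3 a)) * S (S (S3 l))).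
  by ring: two_eq0.
by rewrite C2 C3 C5; field.
Qed.

End Eigenplane.

End Semilinear.

(** * Scatteredness expressed by the equations f(x) = m x *)

Section Scattered.
Variables (F : finFieldType) (L : fieldExtType F).
Variable S : {rmorphism L -> L}.
Hypothesis frobeniusE : forall x, S x = x ^+ #|F|.
Local Notation S3 x := (S (S (S x))).

Lemma iter_frobenius n (x : L) : iter n S x = x ^+ (#|F| ^ n).
Proof. by elim: n => [|n /= ->]; rewrite ?expr1 // frobeniusE -exprM -expnSr. Qed.

Lemma frobenius_fixed (t : L) : S t = t -> exists k : F, t = k%:A.
Proof.
move=> St; apply/vlineP.
by rewrite (Fermat's_little_theorem 1%AS t) dimv1 expn1 -frobeniusE St.
Qed.

Lemma U_spaceE (b : L) (v : (L * L)%type) :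
  v \in U_space b -> v.2 = b * S v.1 + S (S3 v.1).
Proof.
by case/U_spaceP=> x ->; rewrite /= -(iter_frobenius 4) -frobeniusE.
Qed.

Lemma dim_U_space (b : L) : \dim (U_space b) = \dim {:L}.
Proof.
rewrite /U_space limg_dim_eq //; apply/eqP; rewrite capfv; apply/lker0P => x y.
by rewrite !lfunE => -[].
Qed.

(** [U_space b] meets the line spanned by (1, m) in the vectors (x, m x) with f(x) = m x, and the
    line with first coordinate 0 trivially. The vanishing of x y^q + y x^q means that x and y are
    dependent over [F], the ratio being fixed by Frobenius. *)
Lemma scatteredP (b : L) :
    2%:R = 0 :> L ->
    scattered (U_space b) <->
    forall m x y : L, b * S x + S (S3 x) = m * x -> b * S y + S (S3 y) = m * y ->
      x * S y + y * S x = 0.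
Proof.
move=> two_eq0; split=> [scU m x y hx hy | noplane u u_neq0].
  have [-> | x_neq0] := eqVneq x 0; first by rewrite rmorph0 mul0r mulr0 addr0.
  set W := (U_space b :&: Lspan (1%R, m))%VS.
  have memW t : b * S t + S (S3 t) = m * t -> (t, m * t) \in W.
    move=> ht; rewrite memv_cap; apply/andP; split; last first.
      by apply/LspanP; exists t; rewrite /= mulr1 mulrC.
    by apply/U_spaceP; exists t; rewrite -ht -(iter_frobenius 4) -frobeniusE.
  have lineW : W = <[(x, (m * x)%R)]>%VS.
    apply/esym/eqP; rewrite eqEdim -memvE memW // dim_vline.
    have -> : (x, m * x) != 0 by apply: contraNneq x_neq0 => -[->].
    by apply: scU; apply/eqP => -[/eqP]; rewrite oner_eq0.
  have := memW y hy; rewrite lineW => /vlineP[k [-> _]].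
  have -> : S (k *: x) = k *: S x by rewrite !frobeniusE exprZn expf_card.
  rewrite -scalerAr -scalerAl; set t := k *: _.
  by rewrite -mulr2n -mulr_natr two_eq0 mulr0.
set W := (_ :&: _)%VS.
have [-> | v_neq0] := eqVneq W 0%VS; first by rewrite dimv0.
rewrite -vpick0 in v_neq0; have := memv_pick W; move: (vpick W) v_neq0 => v v_neq0 vW.
apply: leq_trans (_ : \dim <[v]> <= 1)%N; last by rewrite dim_vline leq_b1.
apply/dimvS/subvP => v'; move: vW; rewrite !memv_cap.
case/andP=> /U_spaceE v2 /LspanP[c Ev] /andP[/U_spaceE v'2 /LspanP[d Ev']].
have v1_neq0 : v.1 != 0.
  apply: contraNneq v_neq0 => v1; move: v2; rewrite v1 !rmorph0 mulr0 addr0.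
  by case: (v) v1 => /= ? ? -> ->.
have h1 : v.2 = v.2 / v.1 * v.1 by rewrite divfK.
have h2 : v'.2 = v.2 / v.1 * v'.1.
  apply: (mulIf v1_neq0); rewrite mulrAC divfK // Ev Ev' /=; ring.
have := noplane (v.2 / v.1) v.1 v'.1; rewrite -v2 -v'2 => /(_ h1 h2) h0.
have [k Ek] : exists k : F, v'.1 / v.1 = k%:A.
  apply: frobenius_fixed; rewrite rmorphM fmorphV; apply/eqP.
  rewrite eqr_div ?fmorph_eq0 //; apply/eqP/(eq_char2 L two_eq0).
  by rewrite -h0; ring.
apply/vlineP; exists k.
have E1 : v'.1 = k *: v.1 by rewrite -mulr_algl -Ek divfK.
have E2 : v'.2 = k *: v.2 by rewrite h2 E1 -scalerAr -h1.
by rewrite (surjective_pairing v') E1 E2.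
Qed.

Lemma cross_ratio_not_scattered (b z : L) :
    2%:R = 0 :> L -> \dim {:L} = 6%N -> b != 0 ->
    let n0 := b * S3 b in let n1 := S n0 in let n2 := S n1 in
    z * S3 z * n2 = n0 -> n0 * S z * (1 + n2 * z) = n0 + n2 * z ->
    n1 * S (S z) * (z + n0) = n0 + n2 * z ->
  ~ scattered (U_space b).
Proof.
move=> two_eq0 dimL b_neq0; rewrite /= !rmorphM => zz3 Ez1 Ez2.
have S6 x : S3 (S3 x) = x.
  by have := expf_card_dim F L x; rewrite dimL -(iter_frobenius 6).
have z_neq0 : z != 0.
  by apply: contra_eq_neq zz3 => ->; rewrite !mul0r eq_sym mulf_neq0 ?fmorph_eq0.
have Sa k : S k != 0 = (k != 0) by rewrite fmorph_eq0.
have [a a_neq0 Ea] : exists2 a, a != 0 & z * S (S (S3 b)) * a = S3 b * S3 a.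
  (* Hilbert 90 for the involution S^3: as [v] has norm 1, any a = l + v^-1 S^3 l satisfies S^3 a =
     v a, and some [l] makes it nonzero. *)
  pose v := z * S (S (S3 b)) / S3 b.
  have v_neq0 : v != 0 by rewrite !mulf_neq0 ?invr_eq0 ?Sa.
  have Sv : S3 v = v^-1.
    apply: (mulIf v_neq0); rewrite mulVf // /v !(fmorphV, rmorphM) !S6.
    apply: (mulIf b_neq0); apply: (mulIf (_ : S3 b != 0)); first by rewrite !Sa.
    transitivity (z * S3 z * (S (S b) * S (S (S3 b)))); last by rewrite zz3; ring.
    by field; rewrite !Sa b_neq0.
  pose c i : L := nth 0 [:: 1; 0; 0; v^-1] i.
  have [|l] := @linearized_poly_neq0 F L 4 c 0 (isT : (0 < 4)%N) _ (oner_neq0 _).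
    by rewrite dimL.
  rewrite !big_ord_recl big_ord0 /c /= !mul0r !add0r !addr0 mul1r => a_neq0.
  exists (l + v^-1 * S3 l); first by rewrite -(iter_frobenius 3) expr1 in a_neq0.
  rewrite !(rmorphD S) !(rmorphM S) !fmorphV Sv invrK S6.
  rewrite -[z * _](divfK (_ : S3 b != 0)) -/v ?Sa //.
  by field.
have [e [m Em]] := eigenplane_mapP L S two_eq0 S6 b b_neq0 z a a_neq0 Ea zz3 Ez1 Ez2.
set P := eigenplane_map L S b a e in Em.
move=> /(scatteredP b two_eq0) collinear.
pose c i : L := nth 0 [:: 0; a; S (S b) * S (S a); e; b * a; S (S (S3 a))] i.
have [x0 Px0] : exists x0, P x0 != 0.
  have [|x] := @linearized_poly_neq0 F L 6 c 1 isT _ a_neq0; first by rewrite dimL.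
  rewrite !big_ord_recl big_ord0 /c /= mul0r add0r addr0 -!iter_frobenius /= => Px.
  by exists x; rewrite /P /eigenplane_map -!addrA.
(* [c'] lists the coefficients of p S(P l) + P l S(p) as a linearized polynomial in l. The one at l
   is p a, which is nonzero, so some P x is independent of p over [F]. *)
pose p := P x0; pose c' i : L := nth 0 [:: p * a; S p * a;
  p * S a + S p * (S (S b) * S (S a)); p * (S3 b * S3 a) + S p * e;
  p * S e + S p * (b * a); p * (S b * S a) + S p * S (S (S3 a))] i.
have [|//|x] := @linearized_poly_neq0 F L 6 c' 0 isT.
- by rewrite dimL.
- by rewrite mulf_neq0.
rewrite !big_ord_recl big_ord0 /c' /= addr0 expr1 -!iter_frobenius /=.
case/eqP; rewrite -[RHS](collinear m p (P x) (Em _) (Em _)).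
move: p Px0 @c' => p _; rewrite /P /eigenplane_map !(rmorphD S) !(rmorphM S) !S6; ring.
Qed.

End Scattered.

(** * The trace condition as a test of whether [w] lies in F_(q^3) *)

Theorem theorem3p12 (h : nat) (F : finFieldType) (L : fieldExtType F)
    (K : {subfield L}) (b : L)
    (cardF : #|F| = (2 ^ h)%N)
    (dimL : \dim {:L} = 6%N) (dimK : \dim K = 3%N)
    (b_neq0 : b != 0) :
  let q := #|F| in
  let N := b ^+ (q ^ 3 + 1) in
  let A := b ^+ (q + 1) in
  let B := N ^+ (q ^ 2 + q + 1) + N + N ^+ q + N ^+ (q ^ 2) in
  let C := A ^+ (q ^ 3) * (N + 1) ^+ (q ^ 2 + q + 1) in
  max_scattered (U_space b) <->
  [/\ B != 0,
      [/\ N \in K, N != 0 & N != 1] &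
      abs_trace 2 (3 * h) (A * C / B ^+ 2) = 0].
Proof.
move=> q N A B C.
have char2 : 2%N \in [pchar L].
  by rewrite (fmorph_pchar (in_alg L)); apply: card_finPcharP cardF _.
have two_eq0 : 2%:R = 0 :> L by apply: pcharf0.
have [S SE] := exists_frobenius F L.
have SX k x : x ^+ (q ^ k) = iter k S x by rewrite (iter_frobenius F L S SE).
have S6 x : S (S (S (S (S (S x))))) = x.
  by have := expf_card_dim F L x; rewrite dimL SX.
pose n0 := b * S (S (S b)); pose n1 := S n0; pose n2 := S n1.
have S_n0 : S n0 = n1 by [].
have S_n1 : S n1 = n2 by [].
have S_n2 : S n2 = n0 by rewrite /n2 /n1 /n0 !rmorphM !S6; ring.
have EN : N = n0 by rewrite /N exprD SX expr1 mulrC.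
have n0_neq0 : n0 != 0 by rewrite mulf_neq0 ?fmorph_eq0.
have EB : B = n0 * n1 * n2 + n0 + n1 + n2.
  by rewrite /B EN !exprD expr1 SX -SE /= -/n1 -/n2; ring.
have EAC : A * C = n0 * n1 * ((n2 + 1) * (n1 + 1) * (n0 + 1)).
  rewrite /C /A EN !exprD !expr1 !SX -!SE /= !rmorphD !rmorph1 -/n1 -/n2.
  by rewrite /n1 /n0 !rmorphM; ring.
have SB : S B = B by rewrite EB !(S_n0, S_n1, S_n2, rmorphD, rmorphM); ring.
have SXh k x : x ^+ (2 ^ (k * h)) = iter k S x.
  by rewrite mulnC expnM -cardF SX.
pose c := n0 * n2 * (n1 + 1) ^+ 2 / B ^+ 2.
(* A C / B^2 is S c plus some v^2 + v with v fixed by S^3, and its trace from F_(q^3) telescopes for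
   any root [w], even one outside F_(q^3). *)
have trE w : B != 0 -> w ^+ 2 + w = c ->
    abs_trace 2 (3 * h) (A * C / B ^+ 2) = S (S (S (S w)) + w).
  move=> B_neq0 Ew; rewrite EAC EB (trace_class_shift L two_eq0) -?EB //.
  have -> : n1 * n0 * (n2 + 1) ^+ 2 / B ^+ 2 = S (w ^+ 2 + w).
    by rewrite Ew /c !(S_n0, S_n1, S_n2, SB, fmorphV, rmorphM, rmorphXn,
      rmorphD, rmorph1).
  rewrite abs_traceD // abs_trace_rmorph !abs_trace_artin_schreier // !SXh /=.
  rewrite !(S_n0, S_n1, S_n2, SB, fmorphV, rmorphM, rmorphD, rmorph1).
  by rewrite -mulr2n -mulr_natr two_eq0 mulr0 addr0.
split=> [[scU _] | [B_neq0 _ tr0]].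
  have n2_neq0 : n2 != 0 by rewrite !fmorph_eq0.
  have no_z := fun z => cross_ratio_not_scattered F L S SE b z two_eq0 dimL b_neq0.
  have h_gt0 : (0 < h)%N by case: (h) cardF (card_finRing_gt1 F) => [->|].
  have B_neq0 : B != 0.
    (* The 2^(6h)-th power is the identity on [L], so this exponent gives the square root of n0 /
       n2. *)
    apply/eqP => B0; pose z := (n0 / n2) ^+ (2 ^ (6 * h).-1).
    have Ez : z ^+ 2 * n2 = n0.
      rewrite -exprM -expnSr prednK ?muln_gt0 //.
      by rewrite SXh /= S6 divfK.
    rewrite EB in B0.
    have [e1 e2 e3] := degenerate_cross_ratio L S two_eq0
      n0 n1 n2 S_n0 S_n1 S_n2 z B0 Ez.
    exact: (no_z z e1 e2 e3 scU).
  have Sc : S (S (S c)) = c.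
    by rewrite /c !(S_n0, S_n1, S_n2, SB, fmorphV, rmorphM, rmorphXn, rmorphD,
      rmorph1).
  (* As [c] is fixed by S^3, each term of its trace from [L] occurs twice; hence a root [w] always
     exists in [L]. *)
  have tr6 : abs_trace 2 (6 * h) c = 0.
    rewrite /abs_trace (_ : 6 * h = 3 * h + 3 * h)%N; last by rewrite -mulnDl.
    rewrite big_split_ord /=.
    under [X in _ + X]eq_bigr => i _ do rewrite expnD exprM SXh /= Sc.
    by rewrite -mulr2n -mulr_natr two_eq0 mulr0.
  have [w Ew] : exists w : L, w ^+ 2 + w = c.
    apply: (artin_schreier_root (6 * h) (finvect_type L) c) tr6.
    rewrite -(card_vspacef (Vector.class (finvect_type L : vectType F))) card_vspace.
    by rewrite dimL cardF -expnM mulnC.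
  split=> //.
    split; rewrite ?EN //.
      by rewrite Fermat's_little_theorem dimK SX /= -/n1 -/n2 S_n2.
    (* N = 1 would make B a sum of four ones. *)
    apply: contraNneq B_neq0 => n01; rewrite EB /n2 /n1 n01 !rmorph1 !mulr1.
    by apply/eqP; rewrite -addrA; apply: char2_eq.
  rewrite (trE w) //; have [-> | w3] := eqVneq (S (S (S w))) w.
    by rewrite -mulr2n -mulr_natr two_eq0 mulr0 rmorph0.
  rewrite /c EB in Ew B_neq0.
  have [z [e1 e2 e3]] := artin_schreier_cross_ratio L S two_eq0
    n0 n1 n2 S_n0 S_n1 S_n2 n0_neq0 w B_neq0 Ew w3.
  by case: (no_z z e1 e2 e3).
split; last by rewrite dim_U_space.
apply/(scatteredP F L S SE b two_eq0) => m x y hx hy; apply/eqP/negPn/negP => xy.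
have [z [z_neq0 zz3 Qz]] :=
  eigenplane_cross_ratio L S two_eq0 S6 b b_neq0 m x y hx hy xy.
have En1 : S b * S (S (S (S b))) = n1 by rewrite -rmorphM.
have En2 : S (S b) * S (S (S (S (S b)))) = n2 by rewrite -!rmorphM.
rewrite -/n0 En1 En2 in zz3 Qz; rewrite EB in B_neq0.
(* An independent pair x, y yields a [w] moved by S^3, whereas by [trE] the zero trace says that S^3
   fixes it. *)
have [w Ew /eqP[]] := quadratic_root_nonfixed L S two_eq0
  n0 n1 n2 S_n0 S_n1 S_n2 n0_neq0 z B_neq0 z_neq0 zz3 Qz.
rewrite -EB in Ew B_neq0.
have := trE w B_neq0 Ew; rewrite tr0 => /esym/eqP; rewrite fmorph_eq0 => /eqP.
exact: eq_char2.
Qed.
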